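(* Let $s\ge 2r\ge 2$ be integers and put $m=s-2$. For $1\le a\le r-1$ set $b=m-a$, $d=b-a=m-2a$, and define $$\mathcal G_{a,b}(q,t)=\Phi_{a,b}^{d}(t,q)+(t-1)\,\Phi_{a-1,b}^{d+1}(qt,q).$$ Then the $q$-Zeta numerator of the trapezoidal poset $T_{r,s}$ with rank $\rho(i,c)=c-i$ is $$\mathbb{H}_{T_{r,s},\rho}(q,t)=1+\sum_{a=1}^{r-1}\mathcal G_{a,m-a}(q,t).$$ Thus every coefficient of a power of $t$ in $\mathbb{H}_{T_{r,s},\rho}(q,t)$ has an explicit finite Gaussian-binomial expression.
   Context: $q$-Zeta numerator: let $P$ be a finite graded poset with a unique maximum and rank function $\rho:P\to\{0,\dots,H\}$, where $H$ is the maximal rank. For $m\ge 0$ put $A_m(P,\rho;q)=\sum_{x_1\le\cdots\le x_m}q^{\rho(x_1)+\cdots+\rho(x_m)}$ (sum over weak chains in $P$; $A_0=1$). The numerator $\mathbb{H}_{P,\rho}(q,t)$ is the polynomial determined by $\sum_{m\ge 0}A_m(P,\rho;q)t^m=\mathbb{H}_{P,\rho}(q,t)/\prod_{a=0}^{H}(1-q^at)$. Trapezoidal poset: $T_{r,s}=\{(i,c):1\le i\le r,\ i\le c\le s-i\}$, ordered by $(i,c)\le(j,d)\iff i\ge j$ and $c\le d$. Gaussian binomials: for integers $N,k$, $\genfrac{[}{]}{0pt}{}{N}{k}_q=\prod_{u=1}^{k}\frac{1-q^{N-k+u}}{1-q^u}$ if $0\le k\le N$, and $0$ otherwise (including when $N<0$).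 One-boundary polynomial: for integers $a,b,d\ge0$ with $b\le a+d$, $$\Phi_{a,b}^{d}(X,q)=\sum_{\nu\ge0}X^{\nu}q^{\nu^2}\left(\genfrac{[}{]}{0pt}{}{a}{\nu}_q\genfrac{[}{]}{0pt}{}{b}{\nu}_q-q^{d}\genfrac{[}{]}{0pt}{}{b-d+1}{\nu+1}_q\genfrac{[}{]}{0pt}{}{a+d-1}{\nu-1}_q\right).$$ *)

(* Defs.v *)
From HB Require Import structures.
From mathcomp Require Import all_boot all_order all_algebra.
From mathcomp Require Import zify.

Set Implicit Arguments.
Unset Strict Implicit.
Unset Printing Implicit Defensive.

Import Order.TTheory GRing.Theory.
Local Open Scope ring_scope.

Section QZeta.
Variables (F : fieldType) (q : F).
Variables (disp : Order.disp_t) (P : finPOrderType disp).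

(* The setting of the q-Zeta numerator; see trap_rank_graded below. *)
Definition graded_with_max (rho : P -> nat) : Prop :=
  [/\ exists top : P, forall x, (x <= top)%O,
      forall x, (forall y, ~~ (y < x)%O) -> rho x = 0%N &
      forall x y, (x < y)%O -> (forall z, ~~ ((x < z)%O && (z < y)%O)) ->
        rho y = (rho x).+1].

Definition qzeta_value (rho : P -> nat) (m : nat) : F :=
  \sum_(x : m.-tuple P | sorted <=%O x) q ^+ (\sum_(y <- x) rho y)%N.

Definition max_rank (rho : P -> nat) : nat := (\max_(x : P) rho x)%N.

Definition qzeta_denominator (rho : P -> nat) : {poly F} :=
  \prod_(0 <= a < (max_rank rho).+1) (1 - q ^+ a *: 'X).

(* The identity
     H(t) = (sum_(m >= 0) A_m t^m) * prod_(0 <= a <= max_rank) (1 - q^a t)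
   of formal power series in t, read off coefficientwise (Cauchy product). *)
Definition is_qzeta_numerator (rho : P -> nat) (H : {poly F}) : Prop :=
  forall n, H`_n =
    \sum_(k < n.+1) qzeta_value rho k * (qzeta_denominator rho)`_(n - k).

Lemma qzeta_numerator_unique (rho : P -> nat) (H1 H2 : {poly F}) :
  is_qzeta_numerator rho H1 -> is_qzeta_numerator rho H2 -> H1 = H2.
Proof. by move=> h1 h2; apply/polyP => n; rewrite h1 h2. Qed.

End QZeta.

Section Trapezoid.
Variables r s : nat.

Record trapezoid := Trapezoid {
  trap_val :> 'I_r.+1 * 'I_s.+1;
  _ : (1 <= trap_val.1 <= r)%N && (trap_val.1 <= trap_val.2 <= s - trap_val.1)%N
}.

HB.instance Definition _ := [isSub for trap_val].
HB.instance Definition _ := [Finite of trapezoid by <:].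

Definition trap_le (x y : trapezoid) : bool :=
  (y.1 <= x.1)%N && (x.2 <= y.2)%N.

Fact trap_le_refl : reflexive trap_le.
Proof. by move=> x; rewrite /trap_le !leqnn. Qed.

Fact trap_le_anti : antisymmetric trap_le.
Proof.
move=> x y /andP[/andP[h1 h2] /andP[h3 h4]]; apply: val_inj.
rewrite [LHS]surjective_pairing [RHS]surjective_pairing.
by congr (_, _); apply/val_inj/eqP; rewrite /= eqn_leq ?h1 ?h2 ?h3 ?h4.
Qed.

Fact trap_le_trans : transitive trap_le.
Proof.
move=> y x z /andP[h1 h2] /andP[h3 h4].
by rewrite /trap_le (leq_trans h3 h1) (leq_trans h2 h4).
Qed.

Fact trapezoid_display : Order.disp_t. Proof. exact: Order.Disp tt tt. Qed.

HB.instance Definition _ :=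
  Order.Le_isPOrder.Build trapezoid_display trapezoid
    trap_le_refl trap_le_anti trap_le_trans.

Definition trap_rank (x : trapezoid) : nat := (x.2 - x.1)%N.

Lemma trap_ltE (x y : trapezoid) : (x < y)%O =
  [&& (y.1 <= x.1)%N, (x.2 <= y.2)%N & (y.1 < x.1)%N || (x.2 < y.2)%N].
Proof.
rewrite lt_leAnge /Order.le /= /trap_le; lia.
Qed.

Lemma trap_ex (i c : nat) : (0 < i <= r)%N -> (i <= c <= s - i)%N ->
  exists x : trapezoid, x.1 = i :> nat /\ x.2 = c :> nat.
Proof.
move=> hi hc; have ir : (i < r.+1)%N by lia.
have cs : (c < s.+1)%N by lia.
have hx : (1 <= i <= r)%N && (i <= c <= s - i)%N by rewrite hi hc.
by exists (@Trapezoid (Ordinal ir, Ordinal cs) hx).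
Qed.

Lemma trap_rank_graded : (1 <= r)%N -> (2 * r <= s)%N ->
  graded_with_max trap_rank.
Proof.
move=> r1 rs; split.
- have [||x [x1 x2]] := @trap_ex 1 (s - 1); [lia | lia |].
  exists x => -[y hy]; rewrite /Order.le /= /trap_le x1 x2 /=; lia.
- case=> x hx hmin; rewrite /trap_rank /=; apply/eqP; rewrite subn_eq0 leqNgt.
  apply/negP => ltx; have [||y [y1 y2]] := @trap_ex x.1 x.1; [lia | lia |].
  by have := hmin y; rewrite trap_ltE y1 y2 /=; lia.
- move=> [x hx] [y hy]; rewrite trap_ltE /= => hxy hcov.
  rewrite /trap_rank /=; case: (ltnP y.1 x.1) => h1.
    have [||z [z1 z2]] := @trap_ex x.1.-1 x.2; [lia | lia |].
    by have := hcov z; rewrite !trap_ltE z1 z2 /=; lia.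
  have [||z [z1 z2]] := @trap_ex x.1 x.2.+1; [lia | lia |].
  by have := hcov z; rewrite !trap_ltE z1 z2 /=; lia.
Qed.

End Trapezoid.

Section OneBoundary.
Variables (F : fieldType) (q : F).

Definition gauss_binom (N k : int) : F :=
  if (0 <= k) && (k <= N) then
    \prod_(1 <= u < `|k|%N.+1) ((1 - q ^ (N - k + u%:Z)) / (1 - q ^+ u))
  else 0.

Definition Phi_coef (a b d nu : nat) : F :=
  q ^+ (nu ^ 2) *
  (gauss_binom a nu * gauss_binom b nu
   - q ^+ d * gauss_binom (b%:Z - d%:Z + 1) (nu%:Z + 1)
            * gauss_binom (a%:Z + d%:Z - 1) (nu%:Z - 1)).

(* Under the standing assumption b <= a + d the sum over all nu >= 0 stops at
   nu = a. *)
Lemma Phi_coef_eq0 (a b d nu : nat) :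
  (b <= a + d)%N -> (a < nu)%N -> Phi_coef a b d nu = 0.
Proof.
move=> hb hnu; rewrite /Phi_coef /gauss_binom.
rewrite (_ : (nu%:Z <= a%:Z) = false); last by lia.
rewrite (_ : (nu%:Z + 1 <= b%:Z - d%:Z + 1) = false); last by lia.
by rewrite !andbF mulr0 !mul0r subr0 mulr0.
Qed.

Definition Phi (a b d : nat) (X : {poly F}) : {poly F} :=
  \sum_(0 <= nu < a.+1) Phi_coef a b d nu *: X ^+ nu.

(* Here t is the polynomial variable 'X; d = b - a is a true difference as soon
   as a <= b. *)
Definition calG (a b : nat) : {poly F} :=
  Phi a b (b - a) 'X + ('X - 1) * Phi a.-1 b (b - a).+1 (q *: 'X).

(* The coefficient of t^k in calG a b, obtained by collecting powers of t. *)
Definition calG_coef (a b k : nat) : F :=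
  Phi_coef a b (b - a) k
  + (if k is j.+1 then q ^+ j * Phi_coef a.-1 b (b - a).+1 j else 0)
  - q ^+ k * Phi_coef a.-1 b (b - a).+1 k.

End OneBoundary.

(* The field Q(q) of rational functions and its generator q. *)
Definition Qq : fieldType := {fraction {poly rat}}.
Definition qvar : Qq := @tofrac {poly rat} 'X.

(* Main.v *)
(* For x = (i, c) let f_x(t) be the generating function of the weak chains below
   x.  Splitting by whether a chain contains x, and by inclusion-exclusion over
   the lower covers of x,
     (1 - q^(c-i) t) f_(i,c) = f_(i+1,c) + f_(i,c-1) - f_(i+1,c-1),
   so the numerators N(i,c) of f_(i,c) satisfy
     N(i,c) = N(i+1,c) + N(i,c-1) - (1 - q^(c-i-1) t) N(i+1,c-1),
   with N(i,s-i) = N(i,s-i-1) on the boundary and N = 1 for c = i or i = r.  By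
   the q-Pascal rule the one-boundary polynomials satisfy the same recursion and
   boundary condition in (a, b), since the mixed difference of a product of two
   binomials in its two upper indices is a power of q times such a product.
   Hence N(i,c) is the sum over a <= r - i of the polynomials G with
   d = s - 2i - 2a, and the claim is the case (i, c) = (1, s - 1). *)
Require Import Defs.
From mathcomp Require Import all_boot all_order all_algebra.
From mathcomp Require Import zify ring.

Set Implicit Arguments.
Unset Strict Implicit.
Unset Printing Implicit Defensive.

Import Order.TTheory GRing.Theory.
Local Open Scope ring_scope.

(** * Gaussian binomials and the recursion of the one-boundary polynomials *)

Section OneBoundaryRecurrence.
Variables (F : fieldType) (q : F).
Hypothesis q_generic : forall n, q ^+ n.+1 != 1.

Definition qpoch (n : nat) : F := \prod_(1 <= u < n.+1) (1 - q ^+ u).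

Lemma qpochS n : qpoch n.+1 = qpoch n * (1 - q ^+ n.+1).
Proof. by rewrite /qpoch big_nat_recr. Qed.

Lemma qpoch_neq0 n : qpoch n != 0.
Proof.
elim: n => [|n IH]; first by rewrite /qpoch big_geq ?oner_neq0.
by rewrite qpochS mulf_neq0 // subr_eq0 eq_sym.
Qed.

(** Quotient form with natural indices, which turns the q-Pascal rule into a field identity. *)
Definition qbin (n k : nat) : F :=
  if (k <= n)%N then qpoch n / (qpoch k * qpoch (n - k)) else 0.

Lemma qbin_small n k : (n < k)%N -> qbin n k = 0.
Proof. by move=> nk; rewrite /qbin leqNgt nk. Qed.

Lemma qbin0 n : qbin n 0 = 1.
Proof.
by rewrite /qbin subn0 {2}/qpoch big_geq // mul1r divff ?qpoch_neq0.
Qed.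

Lemma qbinn n : qbin n n = 1.
Proof. by rewrite -(qbin0 n) /qbin leqnn subnn subn0 (mulrC (qpoch 0)). Qed.

Lemma qbinS n k : qbin n.+1 k.+1 - qbin n k.+1 = q ^+ (n - k) * qbin n k.
Proof.
case: (ltngtP n k) => [nk|kn|->].
- by rewrite (@qbin_small n.+1) ?(@qbin_small n) ?subrr ?mulr0 //; lia.
- rewrite /qbin ltnS (ltnW kn) kn subSS.
  have [l ->] : exists l, n = (k + l.+1)%N by exists (n - k.+1)%N; lia.
  rewrite addKn (_ : (k + l.+1 - k.+1 = l)%N); last by lia.
  rewrite (qpochS (k + _)%N) !(qpochS k) (qpochS l).
  have hk : 1 - q ^+ k.+1 != 0 by rewrite subr_eq0 eq_sym.
  have hl : 1 - q ^+ l.+1 != 0 by rewrite subr_eq0 eq_sym.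
  have := qpoch_neq0 k; have := qpoch_neq0 l.
  move=> h1 h2; have -> : q ^+ (k + l.+1).+1 = q ^+ k.+1 * q ^+ l.+1.
    by rewrite -exprD addSn.
  by field; rewrite ?h1 ?h2 ?hk ?hl.
- by rewrite subnn (@qbin_small k) // subr0 mul1r !qbinn.
Qed.

Lemma gauss_binomE (n k : nat) : gauss_binom q n k = qbin n k.
Proof.
rewrite /gauss_binom /qbin lez_nat; case: leqP => //= kn.
have [l ->] : exists l, n = (k + l)%N by exists (n - k)%N; lia.
rewrite addKn (_ : (k + l)%N%:Z - k%:Z = l%:Z); last by lia.
elim: k {n kn} => [|k IH].
  by rewrite big_geq // {2}/qpoch big_geq // mul1r divff ?qpoch_neq0.
rewrite big_nat_recr //= IH -exprnP addSn !qpochS addnC.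
have hk : 1 - q ^+ k.+1 != 0 by rewrite subr_eq0 eq_sym.
have h1 := qpoch_neq0 k; have h2 := qpoch_neq0 l.
by rewrite addnS; field; rewrite ?h1 ?h2 ?hk.
Qed.

Lemma Phi_coef0 a b d : Phi_coef q a b d 0 = 1.
Proof.
rewrite /Phi_coef !gauss_binomE !qbin0 /gauss_binom /=.
by rewrite !mul1r mulr0 subr0.
Qed.

(* The truncated subtractions are harmless: where they differ from the integer
   ones, the binomial in [n.+2] vanishes on both sides. *)
Lemma Phi_coefS a b d n : (b <= a + d)%N ->
  Phi_coef q a b d n.+1 = q ^+ (n.+1 ^ 2) * (qbin a n.+1 * qbin b n.+1
    - q ^+ d * qbin (b.+1 - d) n.+2 * qbin (a + d).-1 n).
Proof.
move=> hb; rewrite /Phi_coef !gauss_binomE; congr (_ * (_ - _)).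
have -> : n.+1%:Z + 1 = n.+2%:Z by lia.
have -> : n.+1%:Z - 1 = n%:Z by lia.
case: (leqP d b.+1) => db; last first.
  rewrite (@qbin_small (_ - _)%N); last by lia.
  rewrite {1}/gauss_binom (_ : (n.+2%:Z <= b%:Z - d%:Z + 1) = false); last by lia.
  by rewrite andbF /= mulr0 !mul0r.
have -> : b%:Z - d%:Z + 1 = (b.+1 - d)%N%:Z by lia.
rewrite gauss_binomE.
case: (posnP (a + d)) => ad.
  by rewrite (@qbin_small (_ - _)%N) ?mulr0 ?mul0r //; lia.
have -> : a%:Z + d%:Z - 1 = (a + d).-1%:Z by lia.
by rewrite gauss_binomE.
Qed.

Lemma qbin_subS b d k :
  qbin (b.+1 - d) k.+2 - qbin (b - d) k.+2 = q ^+ (b - d - k.+1) * qbin (b - d) k.+1.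
Proof.
case: (leqP d b) => db; first by rewrite subSn // qbinS.
by rewrite !(@qbin_small (_ - _)%N) ?subr0 ?mulr0 //; lia.
Qed.

(** Taking the mixed difference in a and b, both products gain the same factor q^(a+b-2n) by
    q-Pascal, and (n+1)^2 + a + b - 2n = n^2 + a + b + 1. *)
Lemma Phi_coef_rec a b d n : (b < a + d)%N ->
  Phi_coef q a.+1 b.+1 d n.+1 =
    Phi_coef q a b.+1 d n.+1 + Phi_coef q a.+1 b d n.+1
    - Phi_coef q a b d n.+1 + q ^+ (a + b).+1 * Phi_coef q a b d n.
Proof.
move=> hb.
have [ha1 hb1] := (qbinS a n, qbinS b n).
have hd := qbin_subS b.+1 d n.
have [c had] : exists c, (a + d = c.+1)%N by exists (a + d).-1; lia.
rewrite !Phi_coefS ?addSn ?had //=; try lia.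
(* In the coefficient of X the factor [a+d-1, 0] = 1 is constant in a, so the second product has
   zero mixed difference. *)
case: n => [|n] in ha1 hb1 hd *.
  rewrite Phi_coef0 !qbin0 !subn0 !mulr1 in ha1 hb1 hd *.
  have e1 : q ^+ (a + b).+1 = q ^+ (1 ^ 2) * (q ^+ a * q ^+ b) by rewrite -!exprD.
  rewrite e1 -ha1 -hb1; ring.
rewrite Phi_coefS; last by lia.
have hc := qbinS c n; rewrite had /=.
have e1 : q ^+ (a + b).+1 * q ^+ (n.+1 ^ 2) * (qbin a n.+1 * qbin b n.+1) =
   q ^+ (n.+2 ^ 2) *
   ((q ^+ (a - n.+1) * qbin a n.+1) * (q ^+ (b - n.+1) * qbin b n.+1)).
  case: (leqP n.+1 a) => na; last by rewrite !(@qbin_small a) //; ring.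
  case: (leqP n.+1 b) => nb; last by rewrite !(@qbin_small b) //; ring.
  have -> : q ^+ (a + b).+1 * q ^+ (n.+1 ^ 2) =
      q ^+ (n.+2 ^ 2) * q ^+ (a - n.+1) * q ^+ (b - n.+1).
    by rewrite -!exprD; congr (q ^+ _); nia.
  ring.
have e2 : q ^+ (a + b).+1 * q ^+ (n.+1 ^ 2) * (qbin (b.+1 - d) n.+2 * qbin c n) =
   q ^+ (n.+2 ^ 2) *
   ((q ^+ (b.+1 - d - n.+2) * qbin (b.+1 - d) n.+2) * (q ^+ (c - n) * qbin c n)).
  case: (leqP n.+2 (b.+1 - d)) => na; last first.
    by rewrite !(@qbin_small (b.+1 - d)%N) //; ring.
  case: (leqP n c) => nb; last by rewrite !(@qbin_small c) //; ring.
  have -> : q ^+ (a + b).+1 * q ^+ (n.+1 ^ 2) =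
      q ^+ (n.+2 ^ 2) * q ^+ (b.+1 - d - n.+2) * q ^+ (c - n).
    by rewrite -!exprD; congr (q ^+ _); nia.
  ring.
rewrite -ha1 -hb1 in e1; rewrite -hd -hc in e2.
set x := q ^+ (a + b).+1 in e1 e2 *; set y := q ^+ (n.+1 ^ 2) in e1 e2 *.
have split u v w z : x * (y * (u - w * v * z)) = x * y * u - w * (x * y * (v * z)).
  by ring.
rewrite split e1 e2; ring.
Qed.

(** Here b + 1 - d = a and a + d - 1 = b, so passing from b to b + 1 changes both products by the
    same amount. *)
Lemma Phi_coef_boundary a b d n : b.+1 = (a + d)%N ->
  Phi_coef q a b.+1 d n = Phi_coef q a b d n.
Proof.
case: n => [|n] hb; first by rewrite !Phi_coef0.
rewrite !Phi_coefS -?hb //=.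
have h1 := qbinS b n; have h2 := qbin_subS b.+1 d n.
have e : q ^+ (b - n) * qbin a n.+1 =
    q ^+ d * (q ^+ (b.+1 - d - n.+1) * qbin (b.+1 - d) n.+1).
  have -> : (b.+1 - d = a)%N by lia.
  case: (leqP n.+1 a) => na; last by rewrite !(@qbin_small a) //; ring.
  by rewrite mulrA -exprD; congr (q ^+ _ * _); lia.
rewrite -h2 in e; congr (_ * _); apply/eqP; rewrite -subr_eq0; apply/eqP.
have -> (a1 b1 b0 c1 c0 w z : F) : a1 * b1 - w * c1 * z - (a1 * b0 - w * c0 * z)
   = a1 * (b1 - b0) - w * (c1 - c0) * z by ring.
rewrite h1 -e; ring.
Qed.

(** The scale u covers both arguments in G: t for u = 1 and qt for u = q. *)
Lemma coef_Phi a b d u k : (b <= a + d)%N ->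
  (Phi q a b d (u *: 'X))`_k = u ^+ k * Phi_coef q a b d k.
Proof.
move=> hb; rewrite /Phi coef_sum big_mkord.
under eq_bigr => i _ do rewrite exprZn !coefZ coefXn.
case: (leqP a.+1 k) => ka.
  rewrite Phi_coef_eq0 // mulr0 big1 // => i _.
  by rewrite gtn_eqF ?mulr0 // (leq_trans (ltn_ord i)).
rewrite (bigD1 (Ordinal ka)) //= eqxx big1 ?addr0 ?mulr1 1?mulrC // => i ik.
rewrite (_ : (k == i) = false) ?mulr0 //.
by apply: contraNF ik => /eqP ki; apply/eqP/val_inj.
Qed.

Lemma Phi_boundary a b d u : b.+1 = (a + d)%N ->
  Phi q a b.+1 d (u *: 'X) = Phi q a b d (u *: 'X).
Proof.
by move=> hb; apply/polyP => k; rewrite !coef_Phi ?Phi_coef_boundary ?hb //; lia.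
Qed.

Lemma Phi_rec a b d u : (b < a + d)%N ->
  Phi q a.+1 b.+1 d (u *: 'X) =
    Phi q a b.+1 d (u *: 'X) + Phi q a.+1 b d (u *: 'X)
    - (1 - (q ^+ (a + b).+1 * u) *: 'X) * Phi q a b d (u *: 'X).
Proof.
move=> hb; apply/polyP => k.
rewrite mulrBl mul1r -scalerAl coefB coefD coefB coefZ coefXM.
rewrite !coef_Phi; try lia.
case: k => [|k] /=; first by rewrite !Phi_coef0; ring.
by rewrite Phi_coef_rec // exprS; ring.
Qed.

Lemma Phi_b0 a d u : Phi q a 0 d (u *: 'X) = 1.
Proof.
apply/polyP => -[|k]; rewrite coef_Phi // coef1 /=; first by rewrite Phi_coef0 mulr1.
rewrite Phi_coefS // (@qbin_small 0) // (@qbin_small (_ - _)%N); last by lia.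
ring.
Qed.

Lemma Phi_a0 b d u : Phi q 0 b d (u *: 'X) = 1.
Proof. rewrite /Phi big_nat1 Phi_coef0 expr0; exact: scale1r. Qed.

(* [word_poly a h d] enumerates by [t^des q^maj] the words with [a] letters L and
   [h - a] letters R, preceded by an R in position 0, every prefix of which has
   at most [d] more R than L, the initial R not counted; a descent is a factor
   RL, at the position of its R.  Words starting with L have an extra descent at
   0 and come from the second [Phi]. *)
Definition word_poly (a h d : nat) : {poly F} :=
  if a is a'.+1 then
    if (a <= h)%N then
      Phi q a (h - a) d 'X + ('X - 1) * Phi q a' (h - a) d.+1 (q *: 'X)
    else 0
  else 1.

(** Both [Phi] terms reach their boundary together, since (a+1) + d = a + (d+1). *)
Lemma word_poly_boundary a d :
  word_poly a.+1 (2 * a.+1 + d) d = word_poly a.+1 (2 * a.+1 + d).-1 d.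
Proof.
rewrite /word_poly; do 2![rewrite ifT; last by lia].
have -> : (2 * a.+1 + d - a.+1 = (a + d).+1)%N by lia.
have -> : ((2 * a.+1 + d).-1 - a.+1 = (a + d))%N by lia.
have h1 := @Phi_boundary a.+1 (a + d)%N d 1; rewrite !scale1r in h1.
by rewrite h1 ?Phi_boundary //; lia.
Qed.

Lemma word_poly_add a b d : word_poly a.+1 (a.+1 + b) d =
  Phi q a.+1 b d 'X + ('X - 1) * Phi q a b d.+1 (q *: 'X).
Proof. by rewrite /word_poly leq_addr addKn. Qed.

Lemma word_poly_small a h d : (h < a)%N -> word_poly a h d = 0.
Proof. by case: a => // a ha; rewrite /word_poly leqNgt ha. Qed.

Lemma word_poly_diag a d : word_poly a.+1 a.+1 d = 'X.
Proof.
have h := @Phi_b0 a.+1 d 1; rewrite scale1r in h.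
by rewrite -[in X in word_poly _ X _](addn0 a.+1) word_poly_add h Phi_b0; ring.
Qed.

(* Appending R costs nothing and appending L costs a descent only after an R;
   the last term corrects the weight of a final RL from 1 to [t q^h]. *)
Lemma word_poly_rec a h d : (h.+1 < 2 * a.+1 + d)%N ->
  word_poly a.+1 h.+1 d = word_poly a h d + word_poly a.+1 h d
    - (1 - q ^+ h *: 'X) * word_poly a h.-1 d.
Proof.
move=> hd; case: (ltngtP h a) => [ha|ha|->].
- by rewrite !word_poly_small //; [ring | lia..].
- have [b hb] : exists b, h = (a.+1 + b)%N by exists (h - a.+1)%N; lia.
  have r1 := @Phi_rec a b d 1; rewrite mulr1 !scale1r in r1.
  have -> : h.+1 = (a.+1 + b.+1)%N by lia.
  rewrite (_ : h.-1 = (a + b)%N) ?hb; last by lia.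
  rewrite !word_poly_add r1; last by lia.
  case: a {ha} => [|a] in hb hd r1 *.
    have p0 b' := @Phi_a0 b' d 1; rewrite /= !Phi_a0.
    by have := p0 b; have := p0 b.+1; rewrite scale1r add0n => -> ->; ring.
  rewrite (_ : (a.+2 + b = a.+1 + b.+1)%N) ?word_poly_add; last by lia.
  (* The first index is one lower here, but u = q restores the missing power, so both terms carry
     the same factor 1 - q^h t. *)
  rewrite Phi_rec; last by lia.
  rewrite (_ : (a.+1 + b.+1 = (a.+1 + b).+1)%N) -?exprSr; last by lia.
  by rewrite (_ : (a.+1 + b).+1 = (a + b).+2) //; ring.
- rewrite word_poly_diag (@word_poly_small a.+1) //.
  case: a {hd} => [|a]; last first.
    by rewrite word_poly_diag word_poly_small //=; ring.
  by rewrite /= expr0 scale1r; ring.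
Qed.

(* The numerator of the principal ideal of (i, c) in T_{r,s}, with j = r - i,
   h = c - i and e = s - 2r; the words counted by the summand [a] are the
   saturated chains from (i + a, i + a) to (i, c). *)
Definition chain_numerator (e j h : nat) : {poly F} :=
  \sum_(0 <= a < j.+1) word_poly a h (e + 2 * (j - a)).

Lemma chain_numeratorS e j h : chain_numerator e j.+1 h =
  1 + \sum_(0 <= a < j.+1) word_poly a.+1 h (e + 2 * (j - a)).
Proof. by rewrite /chain_numerator big_nat_recl. Qed.

Lemma chain_numerator_j0 e h : chain_numerator e 0 h = 1.
Proof. by rewrite /chain_numerator big_nat1. Qed.

Lemma chain_numerator_h0 e j : chain_numerator e j 0 = 1.
Proof.
case: j => [|j]; first exact: chain_numerator_j0.
by rewrite chain_numeratorS big1 ?addr0.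
Qed.

Lemma chain_numerator_boundary e j :
  chain_numerator e j (e + 2 * j) = chain_numerator e j (e + 2 * j).-1.
Proof.
case: j => [|j]; first by rewrite !chain_numerator_j0.
rewrite !chain_numeratorS; congr (_ + _); apply: eq_big_nat => a /andP[_ aj].
rewrite (_ : (e + 2 * j.+1 = 2 * a.+1 + (e + 2 * (j - a)))%N); last by lia.
exact: word_poly_boundary.
Qed.

(** Summand a+1 for j+1 and summand a for j share d = e + 2(j-a), so the recursion holds termwise;
    the leading 1 cancels. *)
Lemma chain_numerator_rec e j h : (h.+1 < e + 2 * j.+1)%N ->
  chain_numerator e j.+1 h.+1 = chain_numerator e j h + chain_numerator e j.+1 h
    - (1 - q ^+ h *: 'X) * chain_numerator e j h.-1.
Proof.
move=> hd; rewrite !chain_numeratorS addrCA -addrA; congr (_ + _).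
rewrite /chain_numerator mulr_sumr -big_split -sumrB.
apply: eq_big_nat => a /andP[_ aj].
by rewrite word_poly_rec; last by lia.
Qed.

Lemma chain_numerator_top r s : (2 <= 2 * r)%N -> (2 * r <= s)%N ->
  chain_numerator (s - 2 * r) r.-1 (s - 2) =
    1 + \sum_(1 <= a < r) calG q a (s - 2 - a).
Proof.
move=> r1 rs; rewrite /chain_numerator prednK; last by lia.
rewrite big_ltn; last by lia.
congr (1 + _); apply: eq_big_nat => -[//|a] /andP[_ ar].
rewrite /calG /word_poly ifT /=; last by lia.
suff -> : (s - 2 - a.+1 - a.+1 = s - 2 * r + 2 * (r.-1 - a.+1))%N by [].
by lia.
Qed.

Lemma coef_calG a b k : (0 < a)%N -> (a <= b)%N ->
  (calG q a b)`_k = calG_coef q a b k.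
Proof.
case: a => // a _ ab; rewrite /calG /calG_coef mulrBl mul1r.
have h1 := @coef_Phi a.+1 b (b - a.+1) 1 k; rewrite scale1r expr1n mul1r in h1.
rewrite coefD coefB coefXM h1 ?coef_Phi //=; try lia.
by case: k {h1} => [|k] /=; rewrite ?coef_Phi ?addrA //; lia.
Qed.

End OneBoundaryRecurrence.

(** * Power series quotients with polynomial numerators *)

Section Cauchy.
Variable F : fieldType.
Implicit Types (f g : nat -> F) (p u H K : {poly F}).

(* [H = (sum_k f_k t^k) p] as formal power series. *)
Definition cauchy_num f p H : Prop :=
  forall n, H`_n = \sum_(k < n.+1) f k * p`_(n - k).

(** Truncating the series makes the algebra of polynomials available. *)
Lemma cauchy_numP f p H :
  cauchy_num f p H <->
  forall n m, (m < n)%N -> H`_m = ((\poly_(k < n) f k) * p)`_m.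
Proof.
have E n m : (m < n)%N ->
    ((\poly_(k < n) f k) * p)`_m = \sum_(k < m.+1) f k * p`_(m - k).
  move=> mn; rewrite coefM; apply: eq_bigr => k _.
  by rewrite coef_poly ifT // (leq_trans _ mn) // ltn_ord.
split=> h; first by move=> n m mn; rewrite E // h.
by move=> n; rewrite (h n.+1) // E.
Qed.

Lemma cauchy_numM f p H u : cauchy_num f p H -> cauchy_num f (u * p) (u * H).
Proof.
move=> /cauchy_numP h; apply/cauchy_numP => n m mn.
rewrite mulrCA !coefM; apply: eq_bigr => k _; congr (_ * _).
by apply: h; rewrite (leq_ltn_trans _ mn) // leq_subr.
Qed.

Lemma eq_cauchy_num f g p H : f =1 g -> cauchy_num f p H -> cauchy_num g p H.
Proof. by move=> fg h n; rewrite h; apply: eq_bigr => k _; rewrite fg. Qed.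

Lemma cauchy_numD f g p H K : cauchy_num f p H -> cauchy_num g p K ->
  cauchy_num (fun k => f k + g k) p (H + K).
Proof.
move=> h1 h2 n; rewrite coefD h1 h2 -big_split; apply: eq_bigr => k _.
by rewrite mulrDl.
Qed.

Lemma cauchy_numB f g p H K : cauchy_num f p H -> cauchy_num g p K ->
  cauchy_num (fun k => f k - g k) p (H - K).
Proof.
move=> h1 h2 n; rewrite coefB h1 h2 -sumrB; apply: eq_bigr => k _.
by rewrite mulrBl.
Qed.

Lemma cauchy_num_delta : cauchy_num (fun k => (k == 0%N)%:R) 1 1.
Proof.
move=> n; rewrite big_ord_recl subn0 mul1r big1 ?addr0 // => k _.
by rewrite mul0r.
Qed.

(** The hypothesis on f says (1 - ct) f = g as power series. *)
Lemma cauchy_num_geometric c f g p H :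
  (forall k, f k = g k + (if k is l.+1 then c * f l else 0)) ->
  cauchy_num g p H -> cauchy_num f ((1 - c *: 'X) * p) H.
Proof.
move=> fg /cauchy_numP h; apply/cauchy_numP => n m mn.
rewrite (h n) // mulrA.
suff E l : (l < n)%N ->
    (\poly_(k < n) g k)`_l = ((\poly_(k < n) f k) * (1 - c *: 'X))`_l.
  rewrite !coefM; apply: eq_bigr => k _; congr (_ * _).
  by apply: E; rewrite (leq_trans _ mn) // ltn_ord.
move=> ln; rewrite mulrBr mulr1 -scalerAr coefB coefZ coefMX !coef_poly ln.
case: l ln => [|l] ln /=; first by rewrite fg mulr0 addr0 subr0.
by rewrite (ltnW ln) fg addrK.
Qed.

End Cauchy.

(** * Weighted weak chains inside a subset *)

Section Chains.
Variables (F : fieldType) (q : F).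
Variables (disp : Order.disp_t) (P : finPOrderType disp) (rho : P -> nat).

Definition chain_sum (D : pred P) (k : nat) : F :=
  \sum_(x : k.-tuple P | sorted <=%O x && all D x) q ^+ (\sum_(y <- x) rho y)%N.

Lemma chain_sum0 D : chain_sum D 0 = 1.
Proof.
rewrite /chain_sum (bigD1 [tuple]) //= big_nil expr0 big1 ?addr0 // => x.
by case/andP=> _ /eqP[]; apply: tuple0.
Qed.

Lemma eq_chain_sum D E k : D =1 E -> chain_sum D k = chain_sum E k.
Proof.
by move=> DE; apply: eq_bigl => x; congr (_ && _); apply: eq_all.
Qed.

(** Split off the largest element y; since D is a down-set, the rest of the chain only has to lie
    below y. *)
Lemma chain_sumS (D : pred P) k :
  (forall x y, (x <= y)%O -> D y -> D x) ->
  chain_sum D k.+1 = \sum_(y | D y) q ^+ rho y * chain_sum (<= y)%O k.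
Proof.
move=> Ddown; rewrite /chain_sum.
pose h (u : P * k.-tuple P) : k.+1.-tuple P := [tuple of rcons u.2 u.1].
have hbij : bijective h.
  apply: inj_card_bij; last by rewrite card_prod !card_tuple expnS.
  by move=> [x t] [y u] /(congr1 val)/rcons_inj[/val_inj -> ->].
rewrite (reindex h) /=; last exact: onW_bij.
under [RHS]eq_bigr do rewrite mulr_sumr.
rewrite pair_big_dep; apply: eq_big => -[y x] /=; last first.
  by rewrite big_rcons /= exprD mulrC.
rewrite !(sorted_pairwise le_trans) pairwise_rcons all_rcons.
rewrite andbCA; case Dy: (D y) => //=; rewrite -andbA andbC -andbA; congr (_ && _).
apply: andb_idl => /allP xy; apply/allP => z /xy zy; exact: Ddown zy Dy.
Qed.

Lemma chain_sum_pred0 (D : pred P) k : D =1 pred0 -> chain_sum D k = (k == 0%N)%:R.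
Proof.
move=> D0; case: k => [|k]; first by rewrite chain_sum0.
by rewrite chain_sumS ?big_pred0 // => x y _; rewrite D0.
Qed.

End Chains.

(** * Numerators of the principal ideals of the trapezoid *)

Section TrapezoidNumerator.
Variables (F : fieldType) (q : F) (r s : nat).
Hypothesis q_generic : forall n, q ^+ n.+1 != 1.
Hypotheses (r_gt0 : (0 < r)%N) (le_2r_s : (2 * r <= s)%N).

Definition in_box (i c : nat) : pred (trapezoid r s) :=
  fun y => (i <= y.1)%N && (y.2 <= c)%N.

Definition box_sum (i c k : nat) : F := chain_sum q (@trap_rank r s) (in_box i c) k.

Lemma trapP (y : trapezoid r s) :
  (1 <= y.1 <= r)%N && (y.1 <= y.2 <= s - y.1)%N.
Proof. by case: y. Qed.

Lemma box_sum_empty i c k : (c < i)%N || (r < i)%N -> box_sum i c k = (k == 0%N)%:R.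
Proof.
move=> ci; apply: chain_sum_pred0 => y; apply/negP; rewrite /in_box /=.
by have := trapP y; lia.
Qed.

Lemma box_sumS i c k : box_sum i c k.+1 =
  \sum_(y | in_box i c y) q ^+ trap_rank y * box_sum y.1 y.2 k.
Proof.
rewrite /box_sum chain_sumS //.
by move=> x y; rewrite /Order.le /= /trap_le /in_box; lia.
Qed.

(* The elements below (i, c) lie below (i + 1, c) or (i, c - 1); the recursion
   needs no boundary cases because boxes may stick out of the trapezoid. *)
Lemma box_sum_rec i c k : (0 < i <= r)%N -> (i <= c <= s - i)%N ->
  box_sum i c k.+1 = q ^+ (c - i) * box_sum i c k
    + (box_sum i.+1 c k.+1 + box_sum i c.-1 k.+1 - box_sum i.+1 c.-1 k.+1).
Proof.
move=> hi hc; pose G (y : trapezoid r s) := q ^+ trap_rank y * box_sum y.1 y.2 k.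
have E i' c' : box_sum i' c' k.+1 = \sum_(y | in_box i' c' y) G y by exact: box_sumS.
rewrite !E.
have [x [x1 x2]] := trap_ex hi hc.
(* After removing the boxes that start at i+1, only row i remains, where the bounds c and c-1 differ
   by the single element x. *)
have split c' : \sum_(y | in_box i c' y) G y =
    \sum_(y | in_box i.+1 c' y) G y + \sum_(y | in_box i c' y && (y.1 == i :> nat)) G y.
  rewrite (bigID (fun y : trapezoid r s => (val y).1 == i :> nat)) addrC /=.
  by congr (_ + _); apply: eq_bigl => y; rewrite /in_box; lia.
have Ex : \sum_(y | in_box i c y && (y.1 == i :> nat)) G y =
    q ^+ (c - i) * box_sum i c k +
    \sum_(y | in_box i c.-1 y && (y.1 == i :> nat)) G y.
  rewrite (bigD1 x) /=; last by rewrite /in_box x1 x2; lia.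
  rewrite {1}/G /trap_rank x1 x2; congr (_ + _).
  apply: eq_bigl => y; rewrite /in_box.
  have -> : (y == x) = (y.1 == i :> nat) && (y.2 == c :> nat).
    by rewrite -val_eqE /= -pair_eqE /= -!val_eqE /= x1 x2.
  lia.
rewrite !split Ex; ring.
Qed.

Definition linear_prod (n : nat) : {poly F} := \prod_(0 <= a < n) (1 - q ^+ a *: 'X).

Lemma linear_prodS n : linear_prod n.+1 = (1 - q ^+ n *: 'X) * linear_prod n.
Proof. by rewrite /linear_prod big_nat_recr //= mulrC. Qed.

(** The element (i, i+h) has rank h, so repeating it contributes the new denominator factor 1 - q^h
    t. *)
Lemma box_numerator_step i h H : (0 < i <= r)%N -> (h <= s - 2 * i)%N ->
  cauchy_num (fun k => box_sum i.+1 (i + h) k + box_sum i (i + h).-1 k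
                       - box_sum i.+1 (i + h).-1 k) (linear_prod h) H ->
  cauchy_num (box_sum i (i + h)) (linear_prod h.+1) H.
Proof.
move=> hi hh hH; rewrite linear_prodS; apply: cauchy_num_geometric hH => -[|k].
  by rewrite /box_sum !chain_sum0; ring.
rewrite box_sum_rec ?addKn //; first by rewrite addrC.
lia.
Qed.

Lemma box_numerator j h : (j < r)%N -> (h <= s - 2 * (r - j))%N ->
  cauchy_num (box_sum (r - j) (r - j + h)) (linear_prod h.+1)
    (chain_numerator q (s - 2 * r) j h).
Proof.
elim: j h => [|j IHj]; elim=> [|h IHh] jr hh; apply: box_numerator_step; try lia.
- rewrite chain_numerator_h0 /linear_prod big_geq //.
  apply: eq_cauchy_num (cauchy_num_delta F) => k.
  by rewrite !box_sum_empty ?addrK //; lia.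
- rewrite chain_numerator_j0 -(chain_numerator_j0 q (s - 2 * r) h) //.
  apply: eq_cauchy_num (IHh _ _) => //; last by lia.
  move=> k; have E c : box_sum (r - 0).+1 c k = (k == 0%N)%:R.
    by apply: box_sum_empty; lia.
  rewrite !E addnS /=; ring.
- rewrite chain_numerator_h0 /linear_prod big_geq //.
  apply: eq_cauchy_num (cauchy_num_delta F) => k.
  by rewrite !box_sum_empty ?addrK //; lia.
- set i := (r - j.+1)%N in IHh hh *.
  have ei : (r - j = i.+1)%N by lia.
  have IHh' : cauchy_num (box_sum i (i + h.+1).-1) (linear_prod h.+1)
      (chain_numerator q (s - 2 * r) j.+1 h).
    by rewrite addnS; apply: IHh; lia.
  (* The right side is s - 2i. At equality c = s - i, and the boxes of (i+1, c) and (i+1, c-1)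
     coincide. *)
  case: (ltngtP h.+1 (s - 2 * r + 2 * j.+1)) => hb; last 1 first.
  + rewrite hb chain_numerator_boundary // -hb; apply: eq_cauchy_num IHh' => k.
    suff -> : box_sum i.+1 (i + h.+1) k = box_sum i.+1 (i + h.+1).-1 k by ring.
    by apply: eq_chain_sum => y; rewrite /in_box; have := trapP y; lia.
  + rewrite chain_numerator_rec //.
    apply: cauchy_numB; first apply: cauchy_numD => //.
      by rewrite addnS -addSn -ei; apply: IHj; lia.
    (* The denominator for (i+1, c-1) lacks the last factor 1 - q^h t, which therefore multiplies
       its numerator. *)
    rewrite linear_prodS; apply: cauchy_numM; rewrite addnS /=.
    (* For h = 0 this box is empty, and the default [0.-1 = 0] still gives the correct numerator
       1. *)
    case: h {IHh IHh'} hh hb => [|h] hh hb.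
      rewrite chain_numerator_h0 /linear_prod big_geq //.
      apply: eq_cauchy_num (cauchy_num_delta F) => k.
      by rewrite box_sum_empty //; lia.
    by rewrite addnS -addSn -ei; apply: IHj; lia.
  + by lia.
Qed.

Lemma trap_max_rank : max_rank (@trap_rank r s) = (s - 2)%N.
Proof.
apply/eqP; rewrite eqn_leq; apply/andP; split.
  by apply/bigmax_leqP => y _; rewrite /trap_rank; have := trapP y; lia.
have [||x [x1 x2]] := @trap_ex r s 1 (s - 1); try lia.
by apply: leq_trans (leq_bigmax x); rewrite /trap_rank x1 x2; lia.
Qed.

(** The box of the maximum (1, s-1) is the whole poset. *)
Lemma trap_qzeta_numerator :
  is_qzeta_numerator q (@trap_rank r s) (chain_numerator q (s - 2 * r) r.-1 (s - 2)).
Proof.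
move=> n; rewrite /qzeta_denominator trap_max_rank.
have := @box_numerator r.-1 (s - 2) _ _ n.
rewrite (_ : r - r.-1 = 1)%N => [->|]; try lia.
apply: eq_bigr => k _; congr (_ * _); apply: eq_bigl => x.
rewrite andb_idr // => _; apply/allP => y _; rewrite /in_box.
have := trapP y; lia.
Qed.

End TrapezoidNumerator.

(** * Specialization to the rational function field Q(q) *)

Lemma qvar_generic n : qvar ^+ n.+1 != 1.
Proof.
rewrite -tofracXn -tofrac1 tofrac_eq; apply/negP => /eqP.
move/(congr1 (fun p : {poly rat} => size p)).
by rewrite size_polyXn size_poly1.
Qed.

Theorem theorem4p2 (r s : nat) (hr : (2 <= 2 * r)%N) (hs : (2 * r <= s)%N) :
  let m := (s - 2)%N in
  let num : {poly Qq} := 1 + \sum_(1 <= a < r) calG qvar a (m - a) in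
  is_qzeta_numerator qvar (@trap_rank r s) num /\
  (forall k : nat,
     num`_k = (k == 0%N)%:R + \sum_(1 <= a < r) calG_coef qvar a (m - a) k).
Proof.
move=> m num; split.
  rewrite /num /m -chain_numerator_top //.
  apply: trap_qzeta_numerator => //; last by lia.
  exact: qvar_generic.
move=> k; rewrite /num coefD coef1 coef_sum; congr (_ + _).
apply: eq_big_nat => a /andP[a0 ar]; apply: coef_calG => //; last by rewrite /m; lia.
Qed.
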